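(* Let $X\subset\mathbb{C}^{\mathbb{N}}$ be locally box-open and permutation-invariant, and let $f:X\to\mathbb{C}$ be admissibly holomorphic and $S_{\mathrm{fin}}$-invariant, i.e. $f(x\circ\sigma)=f(x)$ for all $x\in X$ and $\sigma\in S_{\mathrm{fin}}$. Let $c\in\mathbb{C}$. If the constant sequence $x\equiv c$ lies in $X$, then $Df(x)[h]=0$ for all $h\in c_{00}$.
   Context: $c_{00}$ is the space of finitely supported complex sequences indexed by $\mathbb{N}$, with supremum norm $\|\cdot\|_\infty$; $e_k$ is the sequence with $1$ in position $k$ and $0$ elsewhere. $S_{\mathrm{fin}}$ is the group of bijections $\sigma:\mathbb{N}\to\mathbb{N}$ fixing all but finitely many elements, acting on $\mathbb{C}^{\mathbb{N}}$ by $(x\circ\sigma)_n=x_{\sigma(n)}$. A subset $X\subset\mathbb{C}^{\mathbb{N}}$ is permutation-invariant if $x\circ\sigma\in X$ for all $x\in X$, $\sigma\in S_{\mathrm{fin}}$; it is locally box-open if for every $x\in X$ there is $r>0$ with $x+h\in X$ for all $h\in c_{00}$ with $\|h\|_\infty<r$. A function $f:X\to\mathbb{C}$ on such a set is admissibly holomorphic if it carries a differential datum $x\mapsto Df(x)$, where each $Df(x):c_{00}\to\mathbb{C}$ is $\mathbb{C}$-linear, such that: (i) for every $x\in X$ and $k\in\mathbb{N}$, the map $\varepsilon\mapsto f(x+\varepsilon e_k)$ is holomorphic in a neighborhood of $0\in\mathbb{C}$; (ii) for every $x\in X$ there is a constant $C_x$ with $|Df(x)[h]|\le C_x\|h\|_\infty$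 for all $h\in c_{00}$, and $f(x+h)=f(x)+Df(x)[h]+o(\|h\|_\infty)$ as $h\to0$ in $c_{00}$ (with respect to $\|\cdot\|_\infty$). *)

(* Defs.v *)
From HB Require Import structures.
From mathcomp Require Import all_boot all_order all_algebra.
From mathcomp Require Import complex.
From mathcomp Require Import all_classical all_reals all_analysis.

Set Implicit Arguments.
Unset Strict Implicit.
Unset Printing Implicit Defensive.

Import Order.TTheory GRing.Theory Num.Theory.
Import numFieldNormedType.Exports.

Local Open Scope classical_set_scope.
Local Open Scope ring_scope.
Local Open Scope complex_scope.

Definition finitely_supported (R : realType) : {pred nat -> R[i]} :=
  fun u => `[< finite_set [set n | u n != 0] >].
Arguments finitely_supported : clear implicits.

Lemma finitely_supported_submod_closed (R : realType) :
  submod_closed (finitely_supported R).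
Proof.
split=> [|a u v /asboolP uf /asboolP vf]; apply/asboolP.
  by apply: (sub_finite_set _ (finite_set0 nat)) => n /=; rewrite eqxx.
have /sub_finite_set : [set n | (a *: u + v) n != 0] `<=`
    [set n | u n != 0] `|` [set n | v n != 0].
  move=> n /=; apply: contra_neqP => /not_orP[/negP/negPn/eqP un /negP/negPn/eqP vn].
  by rewrite !fctE un vn scaler0 addr0.
by apply; rewrite finite_setU.
Qed.

HB.instance Definition _ (R : realType) :=
  GRing.isSubmodClosed.Build R[i] (nat -> R[i]) (finitely_supported R)
    (finitely_supported_submod_closed R).

Record c00 (R : realType) := C00 {
  c00_val :> nat -> R[i] ;
  _ : c00_val \in finitely_supported R }.

HB.instance Definition _ (R : realType) := [isSub for @c00_val R].
HB.instance Definition _ (R : realType) := [Choice of c00 R by <:].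
HB.instance Definition _ (R : realType) :=
  [SubChoice_isSubLmodule of c00 R by <:].

Definition supnorm (R : realType) (u : c00 R) : R :=
  sup (range (fun n => Normc.normc (u n))).

Lemma normcC (R : realType) (z : R[i]) : `|z| = (Normc.normc z)%:C.
Proof. by []. Qed.

Lemma normc_ge0 (R : realType) (z : R[i]) : 0 <= Normc.normc z.
Proof. by case: z => a b; exact: sqrtr_ge0. Qed.

Lemma le_supnorm (R : realType) (u : c00 R) n : `|u n| <= (supnorm u)%:C.
Proof.
rewrite normcC lecR; apply: ub_le_sup; last by exists n.
have [/= s us] : exists s : seq nat, forall n, u n != 0 -> n \in s.
  have /asboolP/finite_seqP[s us] := valP u.
  by exists s => m um; have : [set n | val u n != 0] m by []; rewrite us.
exists (\sum_(m <- s) Normc.normc (u m)) => _ [m _ <-].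
have [um0|/us ms] := eqVneq (u m) 0.
  by rewrite um0 Normc.normc0; apply: sumr_ge0 => k _; exact: normc_ge0.
by rewrite (big_rem m ms)/= lerDl; apply: sumr_ge0 => k _; exact: normc_ge0.
Qed.

Lemma supnorm_le (R : realType) (u : c00 R) (M : R) :
  (forall n, `|u n| <= M%:C) -> supnorm u <= M.
Proof.
move=> uM; apply: ge_sup; first by exists (Normc.normc (u 0)), 0%N.
by move=> _ [n _ <-]; rewrite -lecR -normcC.
Qed.

Lemma supnorm_ge0 (R : realType) (u : c00 R) : 0 <= supnorm u.
Proof.
by rewrite -lecR; apply: le_trans (le_supnorm u 0); exact: normr_ge0.
Qed.

Definition c00_norm (R : realType) (u : c00 R) : R[i] := (supnorm u)%:C.

Lemma c00_normD (R : realType) (u v : c00 R) :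
  c00_norm (u + v) <= c00_norm u + c00_norm v.
Proof.
rewrite /c00_norm -rmorphD lecR; apply: supnorm_le => n.
rewrite rmorphD; apply: le_trans (lerD (le_supnorm u n) (le_supnorm v n)).
exact: ler_normD.
Qed.

Lemma c00_normZ_le (R : realType) (a : R[i]) (u : c00 R) :
  c00_norm (a *: u) <= `|a| * c00_norm u.
Proof.
rewrite /c00_norm (normcC a) -rmorphM lecR; apply: supnorm_le => n.
by rewrite [_ n]/(a * u n) normrM rmorphM/= ler_wpM2l// le_supnorm.
Qed.

Lemma c00_normZ (R : realType) (a : R[i]) (u : c00 R) :
  c00_norm (a *: u) = `|a| * c00_norm u.
Proof.
apply/le_anti; rewrite c00_normZ_le/=.
have [->|a0] := eqVneq a 0; first by rewrite normr0 mul0r lecR supnorm_ge0.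
rewrite -ler_pdivlMl ?normr_gt0// -normfV.
by rewrite (le_trans _ (c00_normZ_le _ _))// scalerA mulVf// scale1r.
Qed.

Lemma c00_norm0_eq0 (R : realType) (u : c00 R) : c00_norm u = 0 -> u = 0.
Proof.
move=> u0; apply/val_inj/funext => n; apply/eqP.
by rewrite -normr_le0 -u0 le_supnorm.
Qed.

(* The norm of [u : c00 R] takes values in the scalar field R[i]; by
   definition it is [(supnorm u)%:C]. *)
HB.instance Definition _ (R : realType) :=
  Lmodule_isNormed.Build R[i] (c00 R)
    (@c00_normD R) (@c00_normZ R) (@c00_norm0_eq0 R).

Lemma finitely_supported_unit (R : realType) (k : nat) :
  (fun n => (n == k)%:R : R[i]) \in finitely_supported R.
Proof.
apply/asboolP/(sub_finite_set _ (finite_set1 k)) => n /=.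
by have [//|] := eqVneq n k; rewrite eqxx.
Qed.

Definition c00_unit (R : realType) (k : nat) : c00 R :=
  C00 (finitely_supported_unit R k).

Definition S_fin : set (nat -> nat) :=
  [set s : nat -> nat | bijective s /\ finite_set [set n | s n != n]].

Definition permutation_invariant (R : realType) (X : set (nat -> R[i])) : Prop :=
  forall x s, X x -> S_fin s -> X (x \o s).

Definition locally_box_open (R : realType) (X : set (nat -> R[i])) : Prop :=
  forall x, X x -> exists2 r : R, 0 < r &
    forall h : c00 R, supnorm h < r -> X (x + (h : nat -> R[i])).

(* [R[i]^o] is [R[i]] as a normed module over itself, so [derivable _ w 1] is
   complex differentiability at [w]. *)
Definition holomorphic_near (R : realType) (g : R[i] -> R[i]) (z : R[i]) : Prop :=
  \forall w \near (z : R[i]^o), derivable (g : R[i]^o -> R[i]^o) w 1.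

(* Functions X -> C are represented by total functions whose values outside X
   are irrelevant, and likewise for the differential datum [Df]. *)
Definition admissibly_holomorphic (R : realType) (X : set (nat -> R[i]))
    (f : (nat -> R[i]) -> R[i])
    (Df : (nat -> R[i]) -> {linear c00 R -> R[i]^o}) : Prop :=
  [/\ forall x k, X x -> holomorphic_near
        (fun e => f (x + (e *: c00_unit R k : nat -> R[i]))) 0,
      forall x, X x -> exists C : R, forall h : c00 R,
        `|Df x h| <= (C * supnorm h)%:C &
      forall x, X x ->
        (fun h : c00 R => f (x + (h : nat -> R[i])) - f x - Df x h : R[i]^o)
          =o_ (0 : c00 R) id].

Definition S_fin_invariant (R : realType) (X : set (nat -> R[i]))
    (f : (nat -> R[i]) -> R[i]) : Prop :=
  forall x s, X x -> S_fin s -> f (x \o s) = f x.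

(* Main.v *)
Require Import Defs.
From mathcomp Require Import all_boot all_order all_algebra.
From mathcomp Require Import complex.
From mathcomp Require Import all_classical all_reals all_analysis.

Import Order.TTheory GRing.Theory Num.Theory.
Import numFieldNormedType.Exports.

Local Open Scope classical_set_scope.
Local Open Scope ring_scope.
Local Open Scope complex_scope.

(** Exchanging two coordinates fixes the constant sequence [c], so by
    invariance of [f] the partial derivatives of [f] at [c] are all equal to some
    [a]. The sum of the first [n] unit vectors has sup norm at most 1, whence
    boundedness of [Df c] gives [n * |a| <= C] for all [n], that is [a = 0]. *)

Definition swap_nat (j k n : nat) : nat :=
  if n == j then k else if n == k then j else n.

Lemma swap_natK (j k : nat) : involutive (swap_nat j k).
Proof.
move=> n; rewrite /swap_nat; have [->|nj] := eqVneq n j.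
  by have [->|_] := eqVneq k j; rewrite ?eqxx.
have [->|nk] := eqVneq n k; first by rewrite eqxx.
by rewrite (negbTE nj) (negbTE nk).
Qed.

Lemma S_fin_swap_nat (j k : nat) : S_fin (swap_nat j k).
Proof.
split; first exact: inv_bij (swap_natK j k).
apply: (@sub_finite_set _ _ [set j; k]); last exact: finite_set2.
move=> n /=; rewrite /swap_nat; have [->|_] := eqVneq n j; first by left.
by have [->|_] := eqVneq n k; [right|rewrite eqxx].
Qed.

Section c00_lemmas.
Variable R : realType.
Implicit Type h : c00 R.

Lemma c00_valZE (a : R[i]) h n : (a *: h : c00 R) n = a * h n.
Proof. by []. Qed.

Lemma c00_unitE k n : c00_unit R k n = (n == k)%:R.
Proof. by []. Qed.

Lemma c00_val_sum (I : Type) (r : seq I) (F : I -> c00 R) n :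
  (\sum_(i <- r) F i : c00 R) n = \sum_(i <- r) F i n.
Proof.
by elim/big_rec2 : _ => // i _ u _ <-.
Qed.

Lemma c00_norm_unit_le k : `|c00_unit R k| <= 1.
Proof.
rewrite -[`|_|]/((supnorm _)%:C) lecR; apply: supnorm_le => n.
by rewrite c00_unitE normr_nat; case: (n == k); rewrite ?ler01.
Qed.

(** Serves twice: with [a] the coordinates of [h] to decompose [h], and with [a] constantly 1 to
    bound the test vector in the boundedness argument. *)
Lemma c00_sum_unitE (a : nat -> R[i]) n m :
  (\sum_(k < n) a k *: c00_unit R k : c00 R) m = if (m < n)%N then a m else 0.
Proof.
rewrite c00_val_sum.
under eq_bigr => k _ do rewrite c00_valZE c00_unitE.
case: ltnP => [mn|nm].
  rewrite (bigD1 (Ordinal mn)) //= eqxx mulr1 big1 ?addr0 // => k km.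
  by rewrite -(val_eqE k (Ordinal mn)) /= eq_sym in km; rewrite (negbTE km) mulr0.
by rewrite big1 // => k _; rewrite gtn_eqF ?mulr0 // (leq_trans _ nm).
Qed.

Lemma c00_decomp h : exists n, h = \sum_(k < n) h k *: c00_unit R k.
Proof.
have /asboolP/finite_seqP[s hs] := valP h.
(* [s] lists the support of [h]; the successor puts every index of [s] strictly below the cutoff. *)
exists (\max_(k <- s) k).+1; apply/val_inj/funext => m.
rewrite [RHS]c00_sum_unitE; case: ltnP => // sm.
apply/eqP/negPn/negP => hm.
have ms : m \in s by have : [set n | val h n != 0] m by []; rewrite hs.
by have := leq_bigmax_seq (P := xpredT) (F := id) m ms isT; rewrite leqNgt sm.
Qed.

Lemma bounded_unit_const_eq0 (L : {linear c00 R -> R[i]^o}) (C : R) :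
  (forall h, `|L h| <= (C * supnorm h)%:C) ->
  (forall j k, L (c00_unit R j) = L (c00_unit R k)) -> forall h, L h = 0.
Proof.
move=> LC Luu h.
suff L0 k : L (c00_unit R k) = 0.
  have [n ->] := c00_decomp h.
  by rewrite raddf_sum big1 //= => k _; rewrite linearZ_LR L0 scaler0.
(* Test [L] on the sum [u] of the first [n] unit vectors: [L u] grows linearly in [n], while [u]
   stays in the unit ball. *)
have bnd n : Normc.normc (L (c00_unit R k)) *+ n <= `|C|.
  pose u : c00 R := \sum_(i < n) 1 *: c00_unit R i.
  have Lu : L u = L (c00_unit R k) *+ n.
    rewrite raddf_sum /= -[in RHS](card_ord n) -sumr_const.
    by apply: eq_bigr => i _; rewrite scale1r (Luu i k).
  have u1 : supnorm u <= 1.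
    apply: supnorm_le => m; rewrite (c00_sum_unitE (fun=> 1)).
    by case: ifP; rewrite ?normr1 ?normr0 ?ler01.
  have := LC u; rewrite Lu normrMn normcC -rmorphMn lecR => /le_trans; apply.
  (* The sign of [C] is unknown, so the bound passes through its absolute value. *)
  apply: (le_trans (ler_norm _)); rewrite normrM ler_piMr //.
  by rewrite ger0_norm ?supnorm_ge0.
apply/eqP; rewrite -normr_eq0 normcC; apply/eqP.
congr (_%:C); apply/eqP; rewrite eq_le normc_ge0 andbT leNgt; apply/negP => L0.
(* A natural number above the quotient of [|C|] by the modulus of [L (c00_unit R k)] violates
   [bnd]. *)
have := archi_boundP (divr_ge0 (normr_ge0 C) (ltW L0)).
by rewrite ltr_pdivrMr // ltNge mulr_natl bnd.
Qed.

End c00_lemmas.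

Lemma swap_unit_const (R : realType) (c t : R[i]) (j k : nat) :
  ((fun=> c) + (t *: c00_unit R j : nat -> R[i])) \o swap_nat j k =
  (fun=> c) + (t *: c00_unit R k : nat -> R[i]).
Proof.
apply/funext => n /=; congr (c + t * _%:R).
rewrite /swap_nat; have [->|nj] := eqVneq n j; first by rewrite eq_sym.
by have [_|_] := eqVneq n k; rewrite ?eqxx // (negbTE nj).
Qed.

(** Equal steps [t] along two coordinates give points exchanged by a swap, hence equal values of
    [f]. The two linear terms thus differ only by first-order remainders, which are [o(t)]. *)
Lemma derivative_const_unit_eq (R : realType) (X : set (nat -> R[i]))
    (f : (nat -> R[i]) -> R[i]) (L : {linear c00 R -> R[i]^o}) (c : R[i]) :
  locally_box_open X -> S_fin_invariant X f -> X (fun=> c) ->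
  (fun h : c00 R => f ((fun=> c) + (h : nat -> R[i])) - f (fun=> c) - L h : R[i]^o)
     =o_ (0 : c00 R) id ->
  forall j k, L (c00_unit R j) = L (c00_unit R k).
Proof.
move=> X_open f_inv Xc /eqoP fL j k; apply/eqP; rewrite -subr_eq0 -normr_le0.
apply/ler_addgt0Pl => e e0; rewrite addr0.
have [r r0 Xr] := X_open _ Xc.
have Xnear : \forall h \near (0 : c00 R), X ((fun=> c) + c00_val h).
  apply/nbhs_norm0P; exists r%:C; first by rewrite /= ltcR.
  by move=> h /= hr; apply: Xr; rewrite -ltcR.
have e20 : 0 < e / 2 by rewrite divr_gt0.
(* Membership in [X] is kept beside the estimate because invariance of [f] is applied at the
   perturbed point. *)
have /nbhs_norm0P[d /= d0 dP] : \forall h \near (0 : c00 R),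
    `|f ((fun=> c) + c00_val h) - f (fun=> c) - L h| <= e / 2 * `|h| /\
    X ((fun=> c) + c00_val h) by exact: filterI (fL _ e20) Xnear.
(* Halving [d] makes the inequality strict, as unit vectors are only bounded by 1 in norm. *)
pose t := d / 2.
have t0 : 0 < t by rewrite divr_gt0.
have tuP i : `|t *: c00_unit R i| <= t.
  by rewrite normrZ gtr0_norm // ler_piMr ?c00_norm_unit_le // ltW.
have td : t < d by rewrite /t ltr_pdivrMr // ltr_pMr // ltr1n.
have [fj Xj] := dP _ (le_lt_trans (tuP j) td).
have [fk _] := dP _ (le_lt_trans (tuP k) td).
have fjk : f ((fun=> c) + (t *: c00_unit R k : nat -> R[i])) =
    f ((fun=> c) + (t *: c00_unit R j : nat -> R[i])).
  by rewrite -(swap_unit_const _ c t j k) f_inv //; exact: S_fin_swap_nat.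
have Lt i : L (t *: c00_unit R i) = t * L (c00_unit R i) :> R[i].
  exact: linearZ_LR.
rewrite -(ler_pM2l t0) -[t in t * `|_|]gtr0_norm // -normrM.
(* By [fjk] the values of [f] cancel in the difference of the two remainders, each of which is at
   most [e / 2 * t]. *)
have -> : t * (L (c00_unit R j) - L (c00_unit R k)) =
    (f ((fun=> c) + (t *: c00_unit R k : nat -> R[i])) - f (fun=> c)
       - L (t *: c00_unit R k)) -
    (f ((fun=> c) + (t *: c00_unit R j : nat -> R[i])) - f (fun=> c)
       - L (t *: c00_unit R j)).
  by rewrite fjk !Lt mulrBr; set u := f _ - _; rewrite opprB [RHS]addrC addrA subrK.
apply: (le_trans (ler_normB _ _)); rewrite mulrC [e in e * t]splitr mulrDl.
by apply: lerD; [apply: (le_trans fk)|apply: (le_trans fj)];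
   exact: ler_wpM2l (ltW e20) _ _ _.
Qed.

Theorem corollary3p5 (R : realType) (X : set (nat -> R[i]))
  (f : (nat -> R[i]) -> R[i])
  (Df : (nat -> R[i]) -> {linear c00 R -> R[i]^o}) (c : R[i])
  (X_open : locally_box_open X)
  (X_perm : permutation_invariant X)
  (f_hol : admissibly_holomorphic X f Df)
  (f_inv : S_fin_invariant X f)
  (Xc : X (fun=> c)) :
  forall h : c00 R, Df (fun=> c) h = 0.
Proof.
have [_ Df_bounded Df_diff] := f_hol.
have [C DfC] := Df_bounded _ Xc.
apply: bounded_unit_const_eq0 DfC _.
exact: derivative_const_unit_eq X_open f_inv Xc (Df_diff _ Xc).
Qed.
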